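(* Let $F_0=0$, $F_1=1$, $F_2=1,\ldots$ be the Fibonacci sequence, where $F_{i+2}=F_{i+1}+F_i$. Then for any integer $k \geq 3$, a convex polytope with precisely $k$ facets has at most $F_{k+1}$ vertices.
   Context: A convex polytope is the convex hull of finitely many points in some $\mathbb{R}^m$ (equivalently, a bounded intersection of finitely many closed half-spaces); it may have any dimension $d$. Its facets are its faces of dimension $d-1$. *)

(* Defs.v *)
From mathcomp Require Export all_boot all_order all_algebra.
From mathcomp Require Export boolp classical_sets functions cardinality reals.

Set Implicit Arguments.
Unset Strict Implicit.
Unset Printing Implicit Defensive.

Import Order.TTheory GRing.Theory Num.Theory.

Local Open Scope classical_set_scope.
Local Open Scope ring_scope.

Fixpoint fib (n : nat) : nat :=
  match n with
  | 0 => 0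
  | 1 => 1
  | (m.+1 as p).+1 => fib p + fib m
  end%N.

Section Polytopes.
Variables (R : realType) (m : nat).
Implicit Types (P F S : set 'rV[R]_m) (c v x : 'rV[R]_m).

Definition dotv c x : R := \sum_(i < m) c 0 i * x 0 i.

Definition conv_hull S : set 'rV[R]_m :=
  [set x | exists (n : nat) (p : 'I_n -> 'rV[R]_m) (l : 'I_n -> R),
     [/\ forall i, S (p i), forall i, 0 <= l i, \sum_i l i = 1
       & x = \sum_i l i *: p i]].

Definition polytope P : Prop :=
  exists2 V : set 'rV[R]_m, finite_set V & P = conv_hull V.

Definition aff_hull S : set 'rV[R]_m :=
  [set x | exists (n : nat) (p : 'I_n -> 'rV[R]_m) (l : 'I_n -> R),
     [/\ forall i, S (p i), \sum_i l i = 1 & x = \sum_i l i *: p i]].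

(* The dimension is an integer because the empty set has dimension -1; for a
   nonempty [S], [U] is the direction of the affine hull. *)
Definition has_dim S (d : int) : Prop :=
  (S = set0 /\ d = -1) \/
  exists (p : 'rV[R]_m) (U : {vspace 'rV[R]_m}),
    aff_hull S = [set p + u | u in [set u | u \in U]] /\ d = (\dim U)%:Z.

(* Taking [c = 0] and [b] equal to 0 or 1, both [P] and the empty set are faces
   of [P]. *)
Definition face P F : Prop :=
  exists (c : 'rV[R]_m) (b : R),
    (forall x, P x -> dotv c x <= b) /\ F = P `&` [set x | dotv c x = b].

Definition facets P : set (set 'rV[R]_m) :=
  [set F | face P F /\ exists d : int, has_dim P d /\ has_dim F (d - 1)].

Definition vertices P : set 'rV[R]_m := [set v | face P [set v]].

End Polytopes.

(* Main.v *)
From HB Require Import structures.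
From mathcomp Require Import lra zify.
Require Import Defs.

Set Implicit Arguments.
Unset Strict Implicit.
Unset Printing Implicit Defensive.

Import Order.TTheory GRing.Theory Num.Theory.

(** Write [d] for the dimension of the polytope and [k] for its number of
    facets.  The proof goes through the upper bound theorem: there are at most
    [cyclic_bound k d] vertices, which is the number attained, when
    [k > d >= 2], by the polars of the cyclic polytopes.  That number is at most
    [F_(k+1)] by Pascal's rule, because [F_(k+1)] is the sum of the binomials
    [C(k - i, i)].

    The upper bound is obtained in the manner of Alon and Kalai, from a theorem
    on set pairs.  Fix a linear form [l] taking distinct values at the vertices.
    At a vertex [v] the normals of the facets through [v] span the dual of the
    direction space of the polytope ([facets_separate]), so, on that space, [l]
    is a combination of at most [d] of them ([normal_basis]).  Let [J v] collect
    the facets that occur with a positive coefficient and [J' v] those with a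
    nonpositive one.  If all the facets of [J v] pass through another vertex
    [w], only the other terms contribute to [l (w - v)], and they are products
    of two nonpositive numbers; hence [l v <= l w].  So if [l w < l v], then
    [J v] meets the set of facets avoiding [w], which has at most [k - d]
    elements; whereas [J v] is disjoint from the set of facets avoiding [v].
    The skew version of Bollobas's set pair theorem ([skew_set_pairs]) then
    says that at most [C(n + (k - d), n)] vertices have [#|J v| <= n].  As
    [#|J v| + #|J' v| <= d], each vertex has [#|J v| <= d/2] or
    [#|J' v| <= (d-1)/2]; using [l] for the former and [-l] for the latter,
    and adding the two bounds, gives exactly [cyclic_bound k d].

    The polytope may be far from simple: a vertex that lies on more than [d]
    facets only makes the set of facets avoiding it smaller. *)

(** * Fibonacci numbers and binomial coefficients *)

Lemma fibSS n : fib n.+2 = fib n.+1 + fib n.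
Proof. by []. Qed.

Lemma fib_gt0 n : 0 < fib n.+1.
Proof. by elim: n => // n IH; rewrite fibSS addn_gt0 IH. Qed.

Lemma leq_fib_idS n : n.+2 <= fib n.+3.
Proof.
by elim: n => // n IH; rewrite fibSS; have := fib_gt0 n.+1; lia.
Qed.

(** Both sides satisfy the Fibonacci-Pascal recursion
    [f (m + 1) (n + 1) = f m (n + 1) + f m n], so the inequality follows from its
    boundary cases [m = 0] and [n = 0].  It serves in even dimension; the next
    lemma, proved likewise, serves in odd dimension. *)
Lemma even_binomial_sum_le_fib m n :
  'C(m.+1, n.+1) + 'C(m, n) <= fib (m + n).+3.
Proof.
elim: m n => [|m IH] [|n] //.
  by rewrite bin1 bin0 addn0 addn1; apply: leq_fib_idS.
move: (IH n) (IH n.+1); rewrite addnS addSn addnS (fibSS (m + n).+3).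
by rewrite (binS m.+1 n.+1) (binS m n); lia.
Qed.

Lemma odd_binomial_sum_le_fib m n :
  'C(m.+1, n) + 'C(m.+1, n) <= fib (m + n).+3.
Proof.
elim: m n => [|m IH] [|n].
- by [].
- by case: n => // n; rewrite binS bin_small // bin0n.
- by rewrite !bin0 addn0; apply: leq_trans (leq_fib_idS _); lia.
move: (IH n) (IH n.+1); rewrite addnS addSn addnS (fibSS (m + n).+3).
by rewrite (binS m.+1 n); lia.
Qed.

(** The maximum of the upper bound theorem, in the form in which the two halves
    of the vertices contribute: [d./2 + (k - d)] is [k] minus half of [d] rounded
    up.  The convention in dimension 0 reflects that the only vertex falls in
    the first half. *)
Definition cyclic_bound k d :=
  'C(d./2 + (k - d), d./2) +
  (if d is d'.+1 then 'C(d'./2 + (k - d), d'./2) else 0).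

Lemma cyclic_bound_le_fib k d : 3 <= k -> d <= k -> cyclic_bound k d <= fib k.+1.
Proof.
move=> k3; have [K KE] : exists K, K = k.+1 by exists k.+1.
rewrite -KE /cyclic_bound -(odd_double_half d).
case: (odd d) (d./2) => [] n.
  rewrite add1n /= uphalf_double doubleK => dk.
  have [m km] : exists m, n + (k - n.*2.+1) = m.+1.
    by exists (n + (k - n.*2.+1)).-1; lia.
  have -> : K = (m + n).+3 by lia.
  by rewrite km; apply: odd_binomial_sum_le_fib.
case: n => [|n] dk; first by rewrite /= bin0 KE fib_gt0.
rewrite add0n doubleS /= doubleK uphalf_double.
have [m km] : exists m, n + (k - n.*2.+2) = m by exists (n + (k - n.*2.+2)).
have -> : K = (m + n).+3 by lia.
by rewrite addSn km; apply: even_binomial_sum_le_fib.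
Qed.

(** * The skew set pair theorem *)

Section SkewSetPairs.
Local Open Scope ring_scope.

(** Expanding the product of [b] linear forms in [a + 1] variables, the entry is
    a bilinear pairing of the monomials of degree [b] in [x i] with coefficients
    that only depend on [j].  The rank is thus at most the number of monomials,
    which are encoded here as sorted [b]-tuples of variables. *)
Lemma rank_prod_sum (F : fieldType) (T : finType) (a b : nat)
    (x : T -> 'I_a.+1 -> F) (y : T -> 'I_b -> 'I_a.+1 -> F) :
  (\rank (\matrix_(i < #|T|, j < #|T|)
     (\prod_r \sum_s x (enum_val i) s * y (enum_val j) r s)%R) <= 'C(a + b, b))%N.
Proof.
pose S := [set t : b.-tuple 'I_a.+1 | sorted leq (map val t)].
pose mset (f : {ffun 'I_b -> 'I_a.+1}) : b.-tuple 'I_a.+1 :=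
  [tuple of sort (relpre val leq) [tuple f r | r < b]].
have msetS f : mset f \in S.
  by rewrite inE sorted_map; apply: sort_sorted => ? ?; apply: leq_total.
pose X := \matrix_(i < #|T|, t < #|S|)
  \prod_(s <- enum_val t) x (enum_val i) s.
pose Y := \matrix_(t < #|S|, j < #|T|)
  \sum_(f | mset f == enum_val t) \prod_r y (enum_val j) r (f r).
set M := (X in \rank X); suff -> : M = X *m Y.
  by rewrite addnC -(card_sorted_tuples b a) mulmx_max_rank.
rewrite {}/M; apply/matrixP => i j; rewrite !mxE bigA_distr_bigA /=.
rewrite (partition_big mset (mem S)) //= big_enum_val.
apply: eq_bigr => t _; rewrite !mxE mulr_sumr.
apply: eq_bigr => f /eqP <-; rewrite big_split /=; congr (_ * _).
by rewrite (perm_big _ (permEl (perm_sort _ _))) /= big_map big_enum.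
Qed.

(** Polynomial method.  Encode [A x] as the polynomial [g x] whose roots are the
    elements of [A x], of degree at most [a], and pair it with [B y] by
    multiplying its values at the [b] points of [B y].  This pairing vanishes
    exactly when [A x] and [B y] meet, so its matrix is triangular for [h] with
    nonzero diagonal; and it is a product of [b] linear forms in the [a + 1]
    coefficients of [g x], so [rank_prod_sum] bounds its rank. *)
Lemma skew_set_pairs (disp : Order.disp_t) (O : orderType disp) (T : finType)
    (k a b : nat) (A B : T -> {set 'I_k}) (h : T -> O) :
    injective h ->
    (forall x, #|A x| <= a)%N -> (forall x, #|B x| <= b)%N ->
    (forall x, [disjoint A x & B x]) ->
    (forall x y, (h y < h x)%O -> ~~ [disjoint A x & B y]) ->
  (#|T| <= 'C(a + b, a))%N.
Proof.
move=> h_inj Aa Bb AB AB'.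
(* The points are shifted by one so that 0 is free: it is the default value
   that pads [B y] to exactly [b] points, and it is never a root of [g x]. *)
pose pt (i : 'I_k) : rat := i.+1%:R.
pose g x : {poly rat} := \prod_(i in A x) ('X - (pt i)%:P).
pose z y (r : 'I_b) : rat := nth 0 (map pt (enum (B y))) r.
have g_eq0 x t : (g x).[t] = 0 <-> exists2 i, i \in A x & t = pt i.
  rewrite horner_prod; split=> [/eqP/prodf_eq0[i iA]|[i iA ->]].
    by rewrite hornerXsubC subr_eq0 => /eqP; exists i.
  by apply/eqP/prodf_eq0; exists i => //; rewrite hornerXsubC subrr.
pose N x y := \prod_r (g x).[z y r].
have N_eq0 x y : reflect (N x y = 0) (~~ [disjoint A x & B y]).
  apply: (iffP idP) => [/pred0Pn[i /andP[/= iA iB]]|/eqP/prodf_eq0[r _ /eqP]].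
    have ib : (index i (enum (B y)) < b)%N.
      by apply: leq_trans (Bb y); rewrite cardE index_mem mem_enum.
    apply/eqP/prodf_eq0; exists (Ordinal ib) => //=.
    apply/eqP/g_eq0; exists i => //; rewrite /z (nth_map i) ?nth_index //.
      by rewrite mem_enum.
    by rewrite index_mem mem_enum.
  case/g_eq0 => i iA; rewrite /z.
  have [rB|Br] := ltnP r (size (enum (B y))).
    rewrite (nth_map i) // => /eqP; rewrite eqr_nat eqSS => /eqP/val_inj ri.
    by apply/pred0Pn; exists i; rewrite /= iA -ri -mem_enum mem_nth.
  by rewrite nth_default ?size_map // => /esym/eqP; rewrite pnatr_eq0.
pose M := \matrix_(i < #|T|, j < #|T|) N (enum_val i) (enum_val j).
have rkM : (\rank M <= 'C(a + b, b))%N.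
  have -> : M = \matrix_(i < #|T|, j < #|T|) \prod_r \sum_(s < a.+1)
                  (g (enum_val i))`_s * z (enum_val j) r ^+ s.
    apply/matrixP => i j; rewrite !mxE; apply: eq_bigr => r _.
    apply: horner_coef_wide; by rewrite /g -big_enum size_prod_XsubC -cardE ltnS.
  exact: (rank_prod_sum (fun u s => (g u)`_s) (fun v r s => z v r ^+ s)).
(* A nonzero combination [c] of the columns cannot vanish: look at the row of
   the index with [c i != 0] whose value under [h] is largest. *)
rewrite -bin_sub ?leq_addr // addKn; apply: leq_trans rkM; rewrite -mxrank_tr.
suff /eqP -> : row_free M^T by [].
apply/row_freeP; exists (invmx M^T); apply: mulmxV.
rewrite -row_free_unit -kermx_eq0; apply/rowV0P => c /sub_kermxP cM.
apply/eqP/contraT => c_neq0.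
have [i0 ci0] : exists i, c 0 i != 0.
  apply/existsP; apply: contraT; rewrite negb_exists => /forallP c0.
  by case/eqP: c_neq0; apply/rowP => i; rewrite mxE; apply/eqP/negbNE/c0.
case: (@arg_maxP _ _ _ i0 (fun i => c 0 i != 0) (fun i => h (enum_val i)) ci0)
  => i ci imax.
have := congr1 (fun v : 'rV_ _ => v 0 i) cM; rewrite !mxE (bigD1 i) //=.
rewrite big1 ?addr0 => [/eqP|j ji]; last first.
  have [->|cj] := eqVneq (c 0 j) 0; first by rewrite mul0r.
  have hji : (h (enum_val j) < h (enum_val i))%O.
    have /= hij := imax j cj; rewrite lt_neqAle hij andbT.
    by apply: contra ji => /eqP/h_inj/enum_val_inj ->.
  by rewrite !mxE (N_eq0 _ _ (AB' _ _ hji)) mulr0.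
rewrite mulf_eq0 (negbTE ci) !mxE /= => /eqP/N_eq0.
by rewrite AB.
Qed.

End SkewSetPairs.

(** * Linear forms on row vectors *)

Section LinearForms.
Local Open Scope ring_scope.
Variables (R : realType) (m : nat).
Implicit Types (c u v x y : 'rV[R]_m) (W : {vspace 'rV[R]_m}).

Lemma dotvC c x : dotv c x = dotv x c.
Proof. by apply: eq_bigr => i _; rewrite mulrC. Qed.

Lemma dotv_is_linear c : linear (dotv c : 'rV[R]_m -> R^o).
Proof.
move=> t x y; rewrite /dotv scaler_sumr -big_split; apply: eq_bigr => i _.
by rewrite !mxE mulrDr mulrCA.
Qed.

HB.instance Definition _ c :=
  GRing.isLinear.Build R 'rV[R]_m R^o _ (dotv c) (dotv_is_linear c).

Lemma dotvDr c x y : dotv c (x + y) = dotv c x + dotv c y.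
Proof. exact: raddfD. Qed.

Lemma dotvBr c x y : dotv c (x - y) = dotv c x - dotv c y.
Proof. exact: raddfB. Qed.

Lemma dotvZr c t x : dotv c (t *: x) = t * dotv c x.
Proof. exact: linearZ. Qed.

Lemma dotv_sumr c (I : finType) (x : I -> 'rV[R]_m) :
  dotv c (\sum_i x i) = \sum_i dotv c (x i).
Proof. exact: raddf_sum. Qed.

Lemma dotvDl c c' x : dotv (c + c') x = dotv c x + dotv c' x.
Proof. by rewrite !(dotvC _ x) dotvDr. Qed.

Lemma dotvZl t c x : dotv (t *: c) x = t * dotv c x.
Proof. by rewrite !(dotvC _ x) dotvZr. Qed.

Lemma dotvv_eq0 x : (dotv x x == 0) = (x == 0).
Proof.
apply/idP/eqP => [|->]; last by rewrite raddf0.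
rewrite psumr_eq0 => [/allP x0|i _]; last by rewrite -expr2 sqr_ge0.
apply/rowP => i; rewrite mxE; apply/eqP.
by have := x0 i (mem_index_enum _); rewrite /= mulf_eq0 orbb.
Qed.

Lemma dotv_span0 c (s : seq 'rV[R]_m) u :
  {in s, forall q, dotv c q = 0} -> u \in <<s>>%VS -> dotv c u = 0.
Proof.
move=> c0 /(@coord_span _ _ _ (in_tuple s)) ->.
rewrite dotv_sumr big1 // => i _.
by rewrite dotvZr c0 ?mulr0 // mem_nth.
Qed.

Lemma separating_form W x :
  x \notin W -> exists2 c, {in W, forall w, dotv c w = 0} & dotv c x != 0.
Proof.
move=> xW; pose f y := y - projv W y.
have fE : linear f.
  by move=> t y z; rewrite /f linearP scalerBr opprD addrACA.
have [j fxj] : exists j, f x 0 j != 0.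
  apply/existsP; apply: contraNT xW; rewrite negb_exists => /forallP fx0.
  suff /eqP : f x = 0 by rewrite subr_eq0 => /eqP ->; apply: memv_proj.
  by apply/rowP => j; rewrite [RHS]mxE; apply/eqP/negbNE/fx0.
pose fL : {linear 'rV[R]_m -> 'rV[R]_m} :=
  HB.pack f (GRing.isLinear.Build R _ _ _ f fE).
pose c := \row_i f (delta_mx 0 i) 0 j.
have cE y : dotv c y = f y 0 j.
  have -> : f y = \sum_i y 0 i *: f (delta_mx 0 i).
    rewrite {1}(row_sum_delta y) -[LHS]/(fL _) raddf_sum.
    by apply: eq_bigr => i _; apply: (linearZ_LR fL).
  by rewrite summxE; apply: eq_bigr => i _; rewrite [c 0 i]mxE [in RHS]mxE mulrC.
exists c => [w wW|]; rewrite cE //.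
by rewrite /f projv_id // subrr mxE.
Qed.

(** Adding a multiple [t *: z] to a form that is good for [zs], each vector forbids
    at most one value of [t]. *)
Lemma nonvanishing_form (zs : seq 'rV[R]_m) :
  0 \notin zs -> exists c, {in zs, forall z, dotv c z != 0}.
Proof.
elim: zs => [|z zs IH]; first by exists 0.
rewrite inE negb_or eq_sym => /andP[z0 /IH[c cP]].
pose bad := [seq - dotv c y / dotv z y | y <- z :: zs].
pose t := 1 + \sum_(b <- bad) `|b|.
have t_bad : t \notin bad.
  apply/negP => tb; have : t <= \sum_(b <- bad) `|b|.
    rewrite (big_rem t) //= (le_trans (ler_norm t)) // lerDl.
    by apply: sumr_ge0 => b _.
  by rewrite /t gerDr ler10.
exists (c + t *: z) => y yzs; rewrite dotvDl dotvZl.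
have [zy0|zy] := eqVneq (dotv z y) 0.
  rewrite zy0 mulr0 addr0; move: yzs; rewrite inE => /predU1P[yz|/cP//].
  by move: zy0 z0; rewrite yz => /eqP; rewrite dotvv_eq0 => ->.
apply: contraNneq t_bad => ty0; apply/mapP; exists y => //.
by apply: (canRL (mulfK zy)); apply/eqP; rewrite -addr_eq0 addrC ty0.
Qed.

Lemma injective_form (s : seq 'rV[R]_m) :
  exists c, {in s &, injective (dotv c)}.
Proof.
have [|c cP] := @nonvanishing_form
    [seq x <- [seq x - y | x <- s, y <- s] | x != 0].
  by rewrite mem_filter eqxx.
exists c => x y xs ys cxy; apply/eqP; rewrite -subr_eq0; apply: contraT => xy.
have := cP (x - y); rewrite dotvBr cxy subrr eqxx; apply.
by rewrite mem_filter xy; apply/allpairsP; exists (x, y).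
Qed.

(** The zero vector is let in because the directions out of a point include it
    when that point is itself among the generators. *)
Lemma small_perturbation (c c1 : 'rV[R]_m) (qs : seq 'rV[R]_m) :
    {in qs, forall q, dotv c q < 0 \/ q = 0} ->
  exists2 e, 0 < e & {in qs, forall q, dotv (c + e *: c1) q <= 0}.
Proof.
move=> cP; pose ratio q := - dotv c q / (1 + `|dotv c1 q|).
pose e := \big[Num.min/1]_(q <- qs | q != 0) ratio q.
have den q : 0 < 1 + `|dotv c1 q| by rewrite ltr_wpDr.
have e_gt0 : 0 < e.
  rewrite /e big_seq_cond; apply: lt_bigmin => // q /andP[/cP[cq _|->]].
    by rewrite divr_gt0 ?oppr_gt0.
  by rewrite eqxx.
exists e => // q qqs; have [q0|->] := cP q qqs; last by rewrite raddf0.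
have qn0 : q != 0 by apply: contraTneq q0 => ->; rewrite raddf0 ltxx.
have e_le : e <= ratio q by apply: ge_bigmin_seq.
rewrite dotvDl dotvZl; move: e_le; rewrite ler_pdivlMr // => e_le.
have := ler_wpM2l (ltW e_gt0) (ler_norm (dotv c1 q)); lra.
Qed.

Lemma dim_add_line W u : u \notin W -> \dim (W + <[u]>) = (\dim W).+1.
Proof.
move=> uW; rewrite dimv_disjoint_sum ?dim_vline.
  by case: eqP uW => [->|_ _]; rewrite ?mem0v ?addn1.
apply/eqP; rewrite -subv0; apply/subvP => w; rewrite memv_cap.
case/andP => wW /vlineP[t wE]; move: wW; rewrite wE rpredZeq (negbTE uW) orbF.
by move=> /eqP ->; rewrite scale0r mem0v.
Qed.

(** When [qs] lists the differences between the generators of a polytope and one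
    of its points, and [c] is nonpositive on [qs], this is the direction
    space of the face that [c] cuts out at that point. *)
Definition tight_span c (qs : seq 'rV[R]_m) : {vspace 'rV[R]_m} :=
  <<[seq q <- qs | dotv c q == 0%R]>>%VS.

(** Rotate the supporting hyperplane [c = 0] of the cone generated by [qs] until
    it touches along a hyperplane of the span of [qs], keeping the value at [u]
    unchanged.  As long as the tight vectors together with [u] do not span, there
    is a form [c1] vanishing on them and positive on some [q] of [qs]; the largest
    [t] for which [c + t *: c1] is still nonpositive makes a new vector tight. *)
Lemma tighten_form (qs : seq 'rV[R]_m) u c :
    u \in <<qs>>%VS -> {in qs, forall q, dotv c q <= 0} -> dotv c u != 0 ->
  exists c', [/\ {in qs, forall q, dotv c' q <= 0}, dotv c' u != 0
    & (\dim (tight_span c' qs)).+1 = \dim <<qs>>].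
Proof.
move=> uqs; have [n] := ubnP (\dim <<qs>> - \dim (tight_span c qs)).
elim: n c => // n IH c; set T := tight_span c qs; rewrite ltnS => leT cqs cu.
have cT : {in T, forall w, dotv c w = 0}.
  by move=> w; apply: dotv_span0 => q; rewrite mem_filter => /andP[/eqP].
have uT : u \notin T by apply: contra cu => /cT ->.
have Tqs : (T <= <<qs>>)%VS.
  by apply: sub_span; apply: mem_subseq; apply: filter_subseq.
have dimTu := dim_add_line uT.
have Tuqs : (T + <[u]> <= <<qs>>)%VS by rewrite subv_add Tqs -memvE.
have [eqTu|neTu] := eqVneq (T + <[u]>)%VS <<qs>>%VS.
  by exists c; split=> //; rewrite -dimTu eqTu.
have /allPn[q qqs qTu] : ~~ all [in (T + <[u]>)%VS] qs.
  apply: contra neTu => /allP Tuq; rewrite eqEsubv Tuqs.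
  exact/span_subvP.
have [c1 [c1Tu c1q]] : exists c1,
    {in (T + <[u]>)%VS, forall w, dotv c1 w = 0} /\ 0 < dotv c1 q.
  have [c1 c1Tu c1q] := separating_form qTu.
  have [c1q0|c1q0] := ltP 0 (dotv c1 q); first by exists c1.
  exists (- 1 *: c1); split=> [w /c1Tu c1w|]; rewrite dotvZl ?c1w ?mulr0 //.
  by rewrite mulN1r oppr_gt0 lt_neqAle c1q c1q0.
have c1T w : w \in T -> dotv c1 w = 0.
  by move=> wT; apply: c1Tu; apply: subvP wT; apply: addvSl.
pose qi (i : 'I_(size qs)) := qs`_i.
pose ratio i := - dotv c (qi i) / dotv c1 (qi i).
have qi0 : 0 < dotv c1 (qi (Ordinal (etrans (index_mem q qs) qqs))).
  by rewrite /qi /= nth_index.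
case: (@arg_minP _ _ _ _ (fun i => 0 < dotv c1 (qi i)) ratio qi0).
move=> i /= c1i imin; pose t : R := ratio i.
have iqs j : qi j \in qs by apply: mem_nth.
have t_ge0 : 0 <= t by rewrite divr_ge0 ?oppr_ge0 ?cqs // ltW.
apply: (IH (c + t *: c1)) => [|p pqs|]; rewrite ?dotvDl ?dotvZl; last 2 first.
- have [c1p|c1p] := ltP 0 (dotv c1 p); last first.
    by have := cqs _ pqs; have := mulr_ge0_le0 t_ge0 c1p; lra.
  have pi : qi (Ordinal (etrans (index_mem p qs) pqs)) = p.
    by rewrite /qi /= nth_index.
  have : t <= - dotv c p / dotv c1 p.
    by rewrite -{1 2}pi; apply: imin; rewrite /= pi.
  by rewrite ler_pdivlMr // => ?; lra.
- by rewrite c1Tu ?mulr0 ?addr0 //; apply: subvP (memv_line u); apply: addvSr.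
apply: leq_trans leT; apply: ltn_sub2l.
  by rewrite -ltnS -dimTu ltnS dimvS.
have c'T p : p \in T -> dotv (c + t *: c1) p = 0.
  by move=> pT; rewrite dotvDl dotvZl cT // c1T // mulr0 addr0.
set T' := tight_span _ _.
have TT' : (T <= T')%VS.
  apply: sub_span => p; rewrite !mem_filter => /andP[cp pqs].
  by rewrite pqs andbT c'T // memv_span // mem_filter cp.
rewrite ltn_neqAle dimvS // andbT; apply/negP => dimTT'.
have : qi i \in T.
  have /eqP -> : T == T' by rewrite eqEdim TT' (eqP dimTT') leqnn.
  apply: memv_span; rewrite mem_filter iqs andbT dotvDl dotvZl.
  by rewrite /t /ratio divfK ?subrr // gt_eqF.
by move=> /c1T c1i0; rewrite c1i0 ltxx in c1i.
Qed.

End LinearForms.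

(** * The facets through a vertex *)

Section FacetsAtAVertex.
Local Open Scope classical_set_scope.
Local Open Scope ring_scope.
Variables (R : realType) (m : nat).
Implicit Types (c u v x y : 'rV[R]_m) (W U : {vspace 'rV[R]_m}).

Lemma sub_conv_hull (S : set 'rV[R]_m) : S `<=` conv_hull S.
Proof.
move=> x Sx; exists 1, (fun=> x), (fun=> 1); split=> //.
  by rewrite big_ord1.
by rewrite big_ord1 scale1r.
Qed.

Lemma sum_affine n (p : 'I_n -> 'rV[R]_m) (l : 'I_n -> R) v :
  \sum_i l i = 1 -> \sum_i l i *: p i - v = \sum_i l i *: (p i - v).
Proof.
move=> l1; rewrite -{1}[v]scale1r -l1 scaler_suml -sumrB.
by apply: eq_bigr => i _; rewrite scalerBr.
Qed.

Lemma vertex_in (P : set 'rV[R]_m) v : vertices P v -> P v.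
Proof. by move=> [? [? [_ vE]]]; have : [set v] v by []; rewrite {1}vE => -[]. Qed.

Lemma conv_hull_sub (S : set 'rV[R]_m) W v x :
  (forall p, S p -> p - v \in W) -> conv_hull S x -> x - v \in W.
Proof.
move=> SW [n [p [l [Sp _ l1 ->]]]]; rewrite sum_affine //.
by apply: memv_suml => i _; apply: memvZ; apply: SW.
Qed.

(** The number of points in an affine combination is one more than that of the
    directions, the extra point [v] receiving the coefficient that makes the sum
    equal to one. *)
Lemma has_dim_span (S : set 'rV[R]_m) v (qs : seq 'rV[R]_m) :
    S v -> (forall q, q \in qs -> S (v + q)) ->
    (forall x, S x -> x - v \in <<qs>>%VS) ->
  has_dim S (\dim <<qs>>)%:Z.
Proof.
move=> Sv Sq Sqs; right; exists v, <<qs>>%VS; split=> //.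
apply/seteqP; split=> [x [n [p [l [Sp l1 ->]]]]|x [u /= uqs <-]].
  exists (\sum_i l i *: p i - v); last by rewrite addrC subrK.
  by rewrite /= sum_affine // memv_suml // => i _; apply/memvZ/Sqs.
rewrite (@coord_span _ _ _ (in_tuple qs) _ uqs).
set t := coord _; pose s := 1 - \sum_i t i u.
exists (size qs).+1,
  (fun i => if unlift ord0 i is Some j then v + qs`_j else v),
  (fun i => if unlift ord0 i is Some j then t j u else s).
split=> [i||]; first by case: unliftP => // j _; apply/Sq/mem_nth.
- rewrite big_ord_recl unlift_none (eq_bigr (t^~ u)) => [|i _].
    by rewrite subrK.
  by rewrite /= liftK.
- rewrite big_ord_recl unlift_none.
  rewrite [in RHS](eq_bigr (fun i => t i u *: v + t i u *: qs`_i)) => [|i _].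
    by rewrite big_split /= -scaler_suml addrA -scalerDl subrK scale1r.
  by rewrite liftK scalerDr.
Qed.

Definition directions (s : seq 'rV[R]_m) v := [seq p - v | p <- s].

Lemma conv_hull_directions (s : seq 'rV[R]_m) v x :
  conv_hull [set` s] x -> x - v \in <<directions s v>>%VS.
Proof.
by apply: conv_hull_sub => p ps; apply/memv_span/mapP; exists p.
Qed.

Lemma span_directions_eq (s : seq 'rV[R]_m) v w :
    conv_hull [set` s] v -> conv_hull [set` s] w ->
  <<directions s v>>%VS = <<directions s w>>%VS.
Proof.
suff sub x y : conv_hull [set` s] x ->
    (<<directions s x>> <= <<directions s y>>)%VS.
  by move=> sv sw; apply/eqP; rewrite eqEsubv !sub.
move=> sx; apply/span_subvP => _ /mapP[p ps ->].
have -> : p - x = (p - y) - (x - y) by rewrite opprB addrA subrK.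
apply: rpredB; last exact: conv_hull_directions.
by apply/memv_span/mapP; exists p.
Qed.

(** The value 0 only occurs at [v] itself, since [v] is the only point of the
    polytope on the supporting hyperplane. *)
Lemma vertex_form (s : seq 'rV[R]_m) v :
    vertices (conv_hull [set` s]) v ->
  exists c, {in directions s v, forall q, dotv c q < 0 \/ q = 0}.
Proof.
move=> [c [b [cb vE]]]; exists c => _ /mapP[p ps ->].
have : [set v] v by []; rewrite {1}vE => -[/= _ cv].
have sp : conv_hull [set` s] p by apply: sub_conv_hull.
have := cb p sp; rewrite le_eqVlt => /predU1P[cp|cp].
  have -> : p = v by have : [set v] p by rewrite vE.
  by right; rewrite subrr.
by left; rewrite dotvBr cv subr_lt0.
Qed.

Lemma vertex_mem (s : seq 'rV[R]_m) v :
  vertices (conv_hull [set` s]) v -> v \in s.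
Proof.
move=> vP; have [c cP] := vertex_form vP.
have [? [? [_ vE]]] := vP; have : [set v] v by [].
rewrite {1}vE => -[[n [p [l [ps l0 l1 vp]]]] _].
have /eqP : \sum_i l i * - dotv c (p i - v) = 0.
  have /(congr1 (dotv c)) : \sum_i l i *: (p i - v) = 0.
    by rewrite -sum_affine // -vp subrr.
  rewrite raddf0 dotv_sumr => c0.
  transitivity (- \sum_i dotv c (l i *: (p i - v))); last by rewrite c0 oppr0.
  by rewrite -sumrN; apply: eq_bigr => i _; rewrite dotvZr mulrN.
have qs i : p i - v \in directions s v.
  by apply/mapP; exists (p i) => //; apply: ps.
have c_le0 i : dotv c (p i - v) <= 0.
  by case: (cP _ (qs i)) => [/ltW//|->]; rewrite raddf0.
rewrite psumr_eq0 => [/allP lc|i _]; last by rewrite mulr_ge0 ?oppr_ge0.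
have [i li] : exists i, l i != 0.
  apply/existsP; apply: contraT; rewrite negb_exists => /forallP li0.
  move/eqP: l1; rewrite big1 => [|i _]; last by apply/eqP/negbNE.
  by rewrite eq_sym oner_eq0.
have := lc i (mem_index_enum _); rewrite /= mulf_eq0 (negbTE li) oppr_eq0.
case: (cP _ (qs i)) => [/lt_eqF -> //|/subr0_eq <- _]; exact: ps.
Qed.

Lemma facet_of_form (s : seq 'rV[R]_m) v c :
    conv_hull [set` s] v ->
    {in directions s v, forall q, dotv c q <= 0} ->
    (\dim (tight_span c (directions s v))).+1 = \dim <<directions s v>> ->
  facets (conv_hull [set` s])
    (conv_hull [set` s] `&` [set x | dotv c x = dotv c v]).
Proof.
move=> sv cs dimT.
have sq q : q \in directions s v -> conv_hull [set` s] (v + q).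
  by case/mapP => p ps ->; rewrite addrC subrK; apply: sub_conv_hull.
have c_le0 p : [set` s] p -> dotv c (p - v) <= 0.
  by move=> ps; apply/cs/mapP; exists p.
split.
  exists c, (dotv c v); split=> // _ [n [p [l [ps l0 l1 ->]]]].
  rewrite -subr_le0 -dotvBr sum_affine // dotv_sumr sumr_le0 // => i _.
  by rewrite dotvZr mulr_ge0_le0 // c_le0.
exists (\dim <<directions s v>>)%:Z; split.
  by apply: (has_dim_span (v := v)) => // x; apply: conv_hull_directions.
rewrite -dimT intS addrC addKr; apply: (has_dim_span (v := v)) => //.
  move=> q; rewrite mem_filter => /andP[/eqP cq qs]; split; first exact: sq.
  by rewrite /= dotvDr cq addr0.
move=> _ [[n [p [l [ps l0 l1 ->]]]] /= /eqP].
rewrite -subr_eq0 -dotvBr sum_affine // dotv_sumr -oppr_eq0 -sumrN.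
rewrite psumr_eq0 => [/allP lc|i _]; last first.
  by rewrite dotvZr oppr_ge0 mulr_ge0_le0 // c_le0.
apply: memv_suml => i _.
have := lc i (mem_index_enum _).
rewrite /= oppr_eq0 dotvZr mulf_eq0 => /predU1P[->|cpi].
  by rewrite scale0r mem0v.
apply/memvZ/memv_span; rewrite mem_filter cpi; apply/mapP; exists (p i) => //.
exact: ps.
Qed.

(** The normals of the facets through a vertex [v] span the dual of the direction
    space: no direction [u != 0] is parallel to all these facets.  Start from a
    hyperplane supporting the polytope at [v] alone, perturbed so as not to be
    parallel to [u], and rotate it by [tighten_form] until it cuts out a facet.
    The conclusion holds for every equation [c x = b] of that facet, since a
    facet together with a direction transversal to it affinely spans the whole
    polytope. *)
Lemma facets_separate (s : seq 'rV[R]_m) v u :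
    vertices (conv_hull [set` s]) v -> u \in <<directions s v>>%VS -> u != 0 ->
  exists F, [/\ facets (conv_hull [set` s]) F, F v &
    forall c b, F = conv_hull [set` s] `&` [set x | dotv c x = b] ->
      dotv c u != 0].
Proof.
set P := conv_hull _; set qs := directions s v => vP uqs u0.
have Pv := vertex_in vP.
have [c0 c0P] := vertex_form vP.
have [c1 c1qs c1u] :
    exists2 c1, {in qs, forall q, dotv c1 q <= 0} & dotv c1 u != 0.
  have [c0u|] := eqVneq (dotv c0 u) 0.
    have [e e0 eP] := small_perturbation u c0P; exists (c0 + e *: u) => //.
    by rewrite dotvDl dotvZl c0u add0r mulf_neq0 ?dotvv_eq0 // gt_eqF.
  by exists c0 => // q /c0P[/ltW//|->]; rewrite raddf0.
have [c [cqs cu dimT]] := tighten_form uqs c1qs c1u.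
set F := P `&` [set x | dotv c x = dotv c v].
exists F; split=> [||c' b FE]; [exact: facet_of_form | by [] |].
have Fv : F v by [].
have c'T : {in tight_span c qs, forall w, dotv c' w = 0}.
  move=> w; apply: dotv_span0 => q; rewrite mem_filter => /andP[/eqP cq qqs].
  have Fq : F (v + q).
    case/mapP: qqs cq => p ps -> cq; split; last by rewrite /= dotvDr cq addr0.
    by rewrite addrC subrK; apply: sub_conv_hull.
  by move: Fv Fq; rewrite FE => -[_ /= <-] [_ /=]; rewrite dotvDr => ?; lra.
apply/negP => /eqP c'u.
have c'qs : {in <<qs>>%VS, forall w, dotv c' w = 0}.
  have uT : u \notin tight_span c qs.
    apply: contra cu => uT; apply/eqP; apply: dotv_span0 uT => q.
    by rewrite mem_filter => /andP[/eqP].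
  have sub : (tight_span c qs + <[u]> <= <<qs>>)%VS.
    rewrite subv_add -memvE uqs andbT.
    by apply: sub_span; apply: mem_subseq; apply: filter_subseq.
  have -> : <<qs>>%VS = (tight_span c qs + <[u]>)%VS.
    by apply/esym/eqP; rewrite eqEdim sub dim_add_line // dimT leqnn.
  move=> _ /memv_addP[w wT [_ /vlineP[t ->] ->]].
  by rewrite dotvDr dotvZr c'u c'T // mulr0 addr0.
case/negP: cu; apply/eqP; move: uqs; apply: dotv_span0 => _ /mapP[p ps ->].
have : F p.
  rewrite FE; split; first exact: sub_conv_hull.
  move: Fv; rewrite FE => -[_ /= <-].
  by apply/eqP; rewrite -subr_eq0 -dotvBr c'qs // memv_span //; apply: map_f.
by case=> _ /= cp; rewrite dotvBr cp subrr.
Qed.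

End FacetsAtAVertex.

(** * The upper bound theorem *)

Section SignedSupports.
Local Open Scope ring_scope.

(** The combinatorial half of the upper bound theorem, with [I x] for the facets
    through the vertex [x]. The skew set pair theorem is applied to [J] and [h],
    then to [J'] and [- h], on complementary parts of the vertex set. *)
Lemma signed_supports_bound (R : realType) (T : finType) (k d : nat)
    (h : T -> R) (I J J' : T -> {set 'I_k}) :
    injective h -> (forall x, d <= #|I x|)%N ->
    (forall x, J x \subset I x) -> (forall x, J' x \subset I x) ->
    (forall x, #|J x| + #|J' x| <= d)%N ->
    (forall x y, J x \subset I y -> h x <= h y) ->
    (forall x y, J' x \subset I y -> h y <= h x) ->
  (#|T| <= cyclic_bound k d)%N.
Proof.
move=> h_inj dI JI J'I JJ' hJ hJ'.
have cardIC x : (#|~: I x| <= k - d)%N.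
  by have := cardsC (I x); rewrite card_ord; have := dI x; lia.
have bound (g : T -> R) (K : T -> {set 'I_k}) a (D : {pred T}) :
    injective g -> {in D, forall x, #|K x| <= a}%N ->
    (forall x, K x \subset I x) ->
    (forall x y, K x \subset I y -> g x <= g y) ->
    (#|D| <= 'C(a + (k - d), a))%N.
  move=> g_inj Ka KI gK; rewrite -card_sig.
  apply: (skew_set_pairs (A := K \o val) (B := fun x => ~: I (val x))
    (h := g \o val)).
  - by move=> x y /g_inj /val_inj.
  - by move=> x; apply/Ka/(valP x).
  - by move=> x; apply: cardIC.
  - by move=> x; rewrite finset.disjoints_subset finset.setCK; apply: KI.
  - move=> x y /=; rewrite finset.disjoints_subset finset.setCK ltNge.
    exact/contra/gK.
pose D := [pred x | (#|J x| <= d./2)%N].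
rewrite -(cardC D) leq_add //; first exact: (bound h J).
case: d @D dI JJ' cardIC bound => [|d] D dI JJ' _ bound.
  rewrite leqn0; apply/eqP/eq_card0 => x; rewrite !inE.
  by have := JJ' x; rewrite leqn0 addn_eq0 => /andP[/eqP ->].
apply: (bound (-%R \o h) J') => //.
- by move=> x y /oppr_inj /h_inj.
- by move=> x; rewrite !inE -ltnNge; have := JJ' x; lia.
- by move=> x y /hJ' /=; rewrite lerN2.
Qed.

(** The separation hypothesis says that the forms [a i], for [i] in [I], span the
    dual of [U]; [fl] consists of the indices of a basis extracted from them and
    of the coordinates of [c] in that basis. *)
Lemma normal_basis (R : realType) (m k : nat) (U : {vspace 'rV[R]_m})
    (a : 'I_k -> 'rV[R]_m) (I : {set 'I_k}) (c : 'rV[R]_m) :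
    (forall u, u \in U -> (forall i, i \in I -> dotv (a i) u = 0) -> u = 0) ->
  exists fl : ('I_(\dim U) -> 'I_k) * ('I_(\dim U) -> R),
    [/\ injective fl.1, forall j, fl.1 j \in I &
      {in U, forall u, dotv c u = \sum_j fl.2 j * dotv (a (fl.1 j)) u}].
Proof.
move=> sepI; pose e j := (vbasis U)`_j.
pose A := \matrix_(i < k, j < \dim U) if i \in I then dotv (a i) (e j) else 0.
have fullA : row_full A.
  rewrite /row_full -mxrank_tr -/(row_free _) -kermx_eq0.
  apply/rowV0P => y /sub_kermxP yA.
  have : \sum_j y 0 j *: e j = 0.
    apply: sepI => [|i iI].
      by apply: memv_suml => j _; apply/memvZ/vbasis_mem/mem_nth; rewrite size_tuple.
    rewrite dotv_sumr; have := congr1 (fun v : 'rV_ _ => v 0 i) yA.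
    rewrite !mxE => yAi; rewrite -[RHS]yAi; apply: eq_bigr => j _.
    by rewrite !mxE iI dotvZr.
  move/freeP: (basis_free (vbasisP U)) => fr /fr y0.
  by apply/rowP => j; rewrite y0 mxE.
pose f := fullrankfun fullA; pose B := rowsub f A.
have freeB : row_free B by apply: fullrowsub_free.
have fI j : f j \in I.
  apply: contraT => fjI; have : delta_mx 0 j *m B = 0 :> 'rV_ _.
    by rewrite -rowE; apply/rowP => i; rewrite !mxE (negbTE fjI).
  move/eqP; rewrite mulmx_free_eq0 // => /eqP/rowP/(_ j).
  by rewrite !mxE !eqxx => /eqP; rewrite oner_eq0.
have /submxP[l lB] : (\row_j dotv c (e j) <= B)%MS.
  exact/submx_full/fullrowsub_full.
exists (fun j => f j, l 0); split=> [|//|u uU /=].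
  exact: (fullrankfun_inj (rkA := fullA)).
rewrite {1 2}(coord_vbasis uU) dotv_sumr.
under [RHS]eq_bigr => j _ do rewrite dotv_sumr mulr_sumr.
rewrite [RHS]exchange_big /=; apply: eq_bigr => i _; rewrite dotvZr.
have := congr1 (fun v : 'rV_ _ => v 0 i) lB; rewrite !mxE => ->.
rewrite mulr_sumr; apply: eq_bigr => j _.
by rewrite !mxE fI dotvZr mulrCA.
Qed.

End SignedSupports.

Section UpperBound.
Local Open Scope classical_set_scope.
Local Open Scope card_scope.
Local Open Scope ring_scope.

(** This indexing of the facets lets subsets of ['I_k] stand for sets of facets,
    as the set pair theorem requires. *)
Lemma facet_system (R : realType) (m : nat) (P : set 'rV[R]_m) (k : nat) :
    facets P #= `I_k ->
  exists ab : 'I_k -> 'rV[R]_m * R,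
    (forall i x, P x -> dotv (ab i).1 x <= (ab i).2) /\
    (forall F, facets P F ->
      exists i, F = P `&` [set x | dotv (ab i).1 x = (ab i).2]).
Proof.
move=> /card_set_bijP[f [fk f_inj f_surj]].
have /choice[ab abP] (i : 'I_k) : exists ab : 'rV[R]_m * R,
    (forall x, P x -> dotv ab.1 x <= ab.2) /\
    exists2 F, facets P F & f F = i /\ F = P `&` [set x | dotv ab.1 x = ab.2].
  have [F PF fF] := f_surj i (ltn_ord i).
  have [[c [b [cb FE]]] _] := PF.
  by exists (c, b); split=> //; exists F.
exists ab; split=> [i|F PF]; first by case: (abP i).
exists (Ordinal (fk _ PF)); have [_ [G PG [fG <-]]] := abP (Ordinal (fk _ PF)).
by apply: f_inj; rewrite ?inE.
Qed.

(** The dimension [d] is that of the space [U] of directions, which does not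
    depend on the vertex from which the directions are taken. *)
Lemma upper_bound_theorem (R : realType) (m : nat) (s vs : seq 'rV[R]_m)
    (k : nat) v0 :
    facets (conv_hull [set` s]) #= `I_k ->
    uniq vs -> {in vs, forall v, vertices (conv_hull [set` s]) v} ->
    v0 \in vs ->
  exists2 d, (d <= k)%N & (size vs <= cyclic_bound k d)%N.
Proof.
set P := conv_hull _ => /facet_system[ab [abP abF]] vs_uniq vsP v0s.
have vP v : v \in vs -> P v by move=> /vsP; apply: vertex_in.
pose U := <<directions s v0>>%VS.
pose v (x : 'I_(size vs)) := vs`_x.
have vvs x : v x \in vs by apply: mem_nth.
have UE x : U = <<directions s (v x)>>%VS by apply: span_directions_eq; apply: vP.
pose I x := [set i | dotv (ab i).1 (v x) == (ab i).2]%SET.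
have IP x i : i \in I x -> dotv (ab i).1 (v x) = (ab i).2.
  by rewrite inE => /eqP.
have sepI x u : u \in U -> (forall i, i \in I x -> dotv (ab i).1 u = 0) -> u = 0.
  rewrite (UE x) => uU u0; apply/eqP/contraT => un0.
  have [F [PF Fv FP]] := facets_separate (vsP _ (vvs x)) uU un0.
  have [i FE] := abF F PF; have /eqP[] := FP _ _ FE; apply: u0.
  by move: Fv; rewrite FE => -[_ /= cv]; rewrite inE; apply/eqP.
have [c c_inj] := injective_form vs.
have /choice[fl flP] x := normal_basis c (@sepI x).
have fI x : (\dim U <= #|I x|)%N.
  have [f_inj fI _] := flP x.
  rewrite -[X in (X <= _)%N]card_ord -(card_imset _ f_inj) subset_leq_card //.
  by apply/fintype.subsetP => _ /imsetP[j _ ->].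
have UD x y : v y - v x \in U by rewrite (UE x); apply/conv_hull_directions/vP.
exists (\dim U).
  apply: leq_trans (fI (Ordinal (etrans (index_mem v0 vs) v0s))) _.
  by rewrite -[leqRHS]card_ord max_card.
pose J (b : bool) x := [set (fl x).1 j | j in [pred j | (0 < (fl x).2 j) == b]]%SET.
have JI b x : J b x \subset I x.
  by apply/fintype.subsetP => _ /imsetP[j _ ->]; have [_ fjI _] := flP x.
have diff x y i : i \in I x ->
    dotv (ab i).1 (v y - v x) = dotv (ab i).1 (v y) - (ab i).2.
  by move=> /IP <-; rewrite dotvBr.
rewrite -[size vs]card_ord.
apply: (@signed_supports_bound R _ k _ (fun x => dotv c (v x)) I
  (J true) (J false)).
- move=> x y /(c_inj _ _ (vvs x) (vvs y))/eqP.
  by rewrite nth_uniq // => /eqP/val_inj.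
- exact: fI.
- exact: JI.
- exact: JI.
- move=> x; have [f_inj _ _] := flP x; rewrite !card_imset //.
  rewrite -[X in (_ <= X)%N]card_ord -(cardC [pred j | (0 < (fl x).2 j) == true]).
  rewrite leq_add2l subset_leq_card //; apply/fintype.subsetP => j.
  by rewrite !inE; case: ltP.
- move=> x y Jy; rewrite -subr_ge0 -dotvBr.
  have [_ fxI ->] := flP x; last exact: UD.
  apply: sumr_ge0 => j _; rewrite diff //.
  have [lj|lj] := ltP 0 ((fl x).2 j).
    rewrite IP ?subrr ?mulr0 //; apply: (fintype.subsetP Jy).
    by apply: imset_f; rewrite inE lj.
  by rewrite mulr_le0 // subr_le0 abP //; apply: vP.
- move=> x y Jy; rewrite -subr_le0 -dotvBr.
  have [_ fxI ->] := flP x; last exact: UD.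
  apply: sumr_le0 => j _; rewrite diff //.
  have [lj|lj] := ltP 0 ((fl x).2 j).
    by rewrite pmulr_rle0 // subr_le0 abP //; apply: vP.
  rewrite IP ?subrr ?mulr0 //; apply: (fintype.subsetP Jy).
  by apply: imset_f; rewrite inE ltNge lj.
Qed.

End UpperBound.

Local Open Scope classical_set_scope.
Local Open Scope card_scope.

Theorem lemma2 (R : realType) (m : nat) (P : set 'rV[R]_m) (k : nat)
    (polyP : polytope P) (k_ge3 : (3 <= k)%N) (facetsP : facets P #= `I_k) :
  vertices P #<= `I_(fib k.+1).
Proof.
have [V /finite_seqP[s ->] PE] := polyP; move: facetsP; rewrite {}PE => facetsP.
set P' := conv_hull _.
pose vs := undup [seq v <- s | `[< vertices P' v >]].
have vsE : vertices P' = [set` vs].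
  apply/seteqP; split=> v; rewrite /= mem_undup mem_filter.
    by move=> vP; rewrite (vertex_mem vP) andbT; apply/asboolP.
  by case/andP => /asboolP.
have vsI : vertices P' #= `I_(size vs).
  rewrite vsE; apply/card_set_bijP; exists (index^~ vs); split=> [v|v w|i /= ivs].
  - by rewrite /= index_mem.
  - by rewrite !inE /= => vvs wvs /(congr1 (nth v vs)); rewrite !nth_index.
  - by exists (nth 0%R vs i); rewrite /= ?mem_nth // index_uniq ?undup_uniq.
rewrite (card_le_eql vsI) card_le_II.
have [[v0 v0s]|vs0] := pselect (exists v, v \in vs); last first.
  by case E: vs vs0 => [//|v vs'] []; exists v; rewrite mem_head.
have vsP : {in vs, forall v, vertices P' v}.
  by move=> v; rewrite mem_undup mem_filter => /andP[/asboolP].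
have [d dk] := upper_bound_theorem facetsP (undup_uniq _) vsP v0s.
by move/leq_trans; apply; apply: cyclic_bound_le_fib.
Qed.
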